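(* Let $G$ and $H$ be countable infinite groups. Suppose a left-invariant circular order $c$ on $G*H$ admits a dynamical realization $r_c:G*H\to\operatorname{Homeo}^+(S^1)$ which restricts to a minimal action of $G$, i.e. all orbits under the action of $G$ are dense in $S^1$. Then $c$ is not an isolated point of $\mathrm{CO}(G*H)$.
   Context: A left-invariant circular order on a group $\Gamma$ is a map $\phi:\Gamma^3\to\{-1,0,1\}$ such that: (DV) $\phi(x,y,z)=0$ if and only if at least two of $x,y,z$ are equal; (C) $\phi(g_1,g_2,g_3)-\phi(g_0,g_2,g_3)+\phi(g_0,g_1,g_3)-\phi(g_0,g_1,g_2)=0$ for all $g_0,\dots,g_3\in \Gamma$; (H) $\phi(gg_0,gg_1,gg_2)=\phi(g_0,g_1,g_2)$ for all $g,g_0,g_1,g_2\in \Gamma$. The set $\mathrm{CO}(\Gamma)$ of all left-invariant circular orders on $\Gamma$ has the subspace topology from $\{-1,0,1\}^{\Gamma^3}$ (product topology, $\{-1,0,1\}$ discrete). Dynamical realization of a circular order $c$ on a countable group $\Gamma$: view $S^1=[0,1]/\{0=1\}$ with its standard positive circular order. Enumerate $\Gamma=\{g_0,g_1,\dots\}$ and define an injection $i:\Gamma\to S^1$ by $i(g_0)=0$, $i(g_1)=\tfrac12$, and inductively let $i(g_n)$ be the midpoint of the complementary interval of $\{i(g_0),\dots,i(g_{n-1})\}$ for which $i$ remains circular-order-preserving with respect to $c$. The left multiplication action of $\Gamma$ on itself gives an order-preserving action on $i(\Gamma)$, which is extended continuously to $\overline{i(\Gamma)}$ and then to all of $S^1$,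 e.g. by acting linearly on the complementary interval gaps. The resulting injective homomorphism $r_c:\Gamma\to\operatorname{Homeo}^+(S^1)$ is a dynamical realization of $c$; the marked point $p=i(e)$ has trivial stabilizer, and $c(g_1,g_2,g_3)$ is the orientation of $(r_c(g_1)p,r_c(g_2)p,r_c(g_3)p)$ in $S^1$. *)

(* Defs.v *)
From HB Require Import structures.
From mathcomp Require Import all_boot all_order all_algebra.
From mathcomp Require Import all_classical all_reals all_analysis.
Set Implicit Arguments.
Unset Strict Implicit.
Unset Printing Implicit Defensive.
Import Order.TTheory GRing.Theory Num.Theory.

Local Open Scope classical_set_scope.

Section FreeProduct.
Variables G H : groupType.
Implicit Types (a b : G + H) (u v w : seq (G + H)).
Local Open Scope group_scope.

Definition letter1 a : bool :=
  match a with inl g => g == 1 | inr h => h == 1 end.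

Definition same_factor a b : bool :=
  match a, b with inl _, inl _ | inr _, inr _ => true | _, _ => false end.

Definition letterV a : G + H :=
  match a with inl g => inl g^-1 | inr h => inr h^-1 end.

(* No letter is trivial and consecutive letters lie in different factors. *)
Definition reduced w : bool :=
  all (predC letter1) w && sorted (fun a b => ~~ same_factor a b) w.

(* Left multiplication of a reduced word by a letter. *)
Definition push a w : seq (G + H) :=
  if letter1 a then w else
  match a, w with
  | inl g, inl g' :: w' => if g * g' == 1 then w' else inl (g * g') :: w'
  | inr h, inr h' :: w' => if h * h' == 1 then w' else inr (h * h') :: w'
  | _, _ => a :: w
  end.

Lemma reduced_tail a w : reduced (a :: w) -> reduced w.
Proof.
rewrite /reduced /= => /andP[/andP[_ ->]] /=; exact: path_sorted.
Qed.

Lemma push_reduced a w : reduced w -> reduced (push a w).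
Proof.
rewrite /push; case: ifPn => // a1 rw.
case: a w a1 rw => [g|h] [|[g'|h'] w] //= a1;
  rewrite /reduced /= ?a1 //=; move=> /andP[/andP[b1 aw] pw].
- case: ifPn => gg; rewrite /= ?aw ?(path_sorted pw) ?gg //=.
  by case: w pw {aw} => [|[]].
- case: ifPn => gg; rewrite /= ?aw ?(path_sorted pw) ?gg //=.
  by case: w pw {aw} => [|[]].
Qed.

Lemma push_cons a w : reduced (a :: w) -> push a w = a :: w.
Proof.
rewrite /reduced /push /=; move=> /andP[/andP[a1 _] pw]; rewrite (negbTE a1).
by case: a w pw {a1} => [g|h] [|[g'|h'] w].
Qed.

Lemma push1 a w : letter1 a -> push a w = w.
Proof. by rewrite /push => ->. Qed.

Lemma pushV a w : reduced w -> push (letterV a) (push a w) = w.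
Proof.
have V1 b : letter1 (letterV b) = letter1 b by case: b => x /=; rewrite invg_eq1.
rewrite /reduced => /andP[al pw].
have [a1|a1] := boolP (letter1 a); first by rewrite !push1 ?V1.
rewrite /push V1 (negbTE a1).
case: a a1 => [g|h] /= a1; case: w al pw => [|[g'|h'] w] //=.
all: rewrite ?mulVg ?eqxx // => /andP[b1 al] pw.
- case: ifPn => [/eqP gg|gg]; last by rewrite mulKg (negbTE b1).
  have -> : g^-1 = g' by rewrite -(mulKg g g') gg mulg1.
  by case: w pw {al} => [|[]].
- case: ifPn => [/eqP gg|gg]; last by rewrite mulKg (negbTE b1).
  have -> : h^-1 = h' by rewrite -(mulKg h h') gg mulg1.
  by case: w pw {al} => [|[]].
Qed.

Lemma push_inlM (g g' : G) w :
  reduced w -> push (inl (g * g')) w = push (inl g) (push (inl g') w).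
Proof.
rewrite /reduced => /andP[al pw].
have [->|g1] := eqVneq g 1; first by rewrite mul1g [RHS]push1 //= eqxx.
have [->|g'1] := eqVneq g' 1; first by rewrite mulg1 [push (inl 1) _]push1 //= eqxx.
rewrite /push /= (negbTE g1) (negbTE g'1).
case: w al pw => [|[x|h] w] //= /andP[x1 al] pw.
have wl y : match w with
  | inl g'' :: w' => if y * g'' == 1 then w' else inl (y * g'') :: w'
  | _ => inl y :: w end = inl y :: w by case: w pw {al} => [|[]].
have [gg|gg] := eqVneq (g * g') 1.
  have [g'x|g'x] := eqVneq (g' * x) 1; last by rewrite mulgA gg mul1g (negbTE x1).
  rewrite wl; congr (inl _ :: _).
  by rewrite -[LHS]mul1g -gg -mulgA g'x mulg1.
have [g'x|g'x] := eqVneq (g' * x) 1; last by rewrite mulgA.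
by rewrite wl -mulgA g'x mulg1 (negbTE g1).
Qed.

Lemma push_inrM (g g' : H) w :
  reduced w -> push (inr (g * g')) w = push (inr g) (push (inr g') w).
Proof.
rewrite /reduced => /andP[al pw].
have [->|g1] := eqVneq g 1; first by rewrite mul1g [RHS]push1 //= eqxx.
have [->|g'1] := eqVneq g' 1; first by rewrite mulg1 [push (inr 1) _]push1 //= eqxx.
rewrite /push /= (negbTE g1) (negbTE g'1).
case: w al pw => [|[h|x] w] //= /andP[x1 al] pw.
have wl y : match w with
  | inr g'' :: w' => if y * g'' == 1 then w' else inr (y * g'') :: w'
  | _ => inr y :: w end = inr y :: w by case: w pw {al} => [|[]].
have [gg|gg] := eqVneq (g * g') 1.
  have [g'x|g'x] := eqVneq (g' * x) 1; last by rewrite mulgA gg mul1g (negbTE x1).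
  rewrite wl; congr (inr _ :: _).
  by rewrite -[LHS]mul1g -gg -mulgA g'x mulg1.
have [g'x|g'x] := eqVneq (g' * x) 1; last by rewrite mulgA.
by rewrite wl -mulgA g'x mulg1 (negbTE g1).
Qed.

Definition word_mul u v : seq (G + H) := foldr push v u.
Definition word_inv u : seq (G + H) := rev (map letterV u).

Lemma word_mul_reduced u v : reduced v -> reduced (word_mul u v).
Proof. by move=> rv; elim: u => //= a u; apply: push_reduced. Qed.

Lemma word_mulw0 u : reduced u -> word_mul u [::] = u.
Proof.
elim: u => //= a u IH rau; rewrite IH ?push_cons //; exact: reduced_tail rau.
Qed.

Lemma word_mul_push a u v :
  reduced u -> reduced v -> word_mul (push a u) v = push a (word_mul u v).
Proof.
rewrite {1}/push; case: ifPn => [a1 _ _|a1]; first by rewrite push1.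
case: a a1 => [g|h] a1; case: u => [|[g'|h'] u] //= ru rv.
- rewrite -push_inlM; last exact: word_mul_reduced.
  by case: eqP => [->|//]; rewrite push1 //= eqxx.
- rewrite -push_inrM; last exact: word_mul_reduced.
  by case: eqP => [->|//]; rewrite push1 //= eqxx.
Qed.

Lemma word_mulA u v w :
  reduced v -> reduced w ->
  word_mul u (word_mul v w) = word_mul (word_mul u v) w.
Proof.
move=> rv rw; elim: u => //= a u ->.
by rewrite word_mul_push // word_mul_reduced.
Qed.

Lemma letterVK : involutive letterV.
Proof. by case=> x /=; rewrite invgK. Qed.

Lemma word_inv_reduced u : reduced u -> reduced (word_inv u).
Proof.
rewrite /reduced /word_inv all_rev all_map rev_sorted sorted_map.
move=> /andP[al s]; apply/andP; split.
  by apply: sub_all al => -[x|x] /=; rewrite invg_eq1.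
by apply: sub_sorted s => -[x|x] [y|y].
Qed.

Lemma word_mulVw u : reduced u -> word_mul (word_inv u) u = [::].
Proof.
elim: u => //= a u IH rau; have ru := reduced_tail rau.
rewrite /word_inv /= rev_cons /word_mul foldr_rcons.
by rewrite -(push_cons rau) pushV //; exact: IH.
Qed.

(* [G * H], realized as the set of reduced words. *)
Definition freeprod := {w : seq (G + H) | reduced w}.
HB.instance Definition _ := SubType.on freeprod.
HB.instance Definition _ := Choice.on freeprod.

Definition fp_one : freeprod := exist reduced [::] isT.
Definition fp_mul (x y : freeprod) : freeprod :=
  exist reduced _ (word_mul_reduced (val x) (valP y)).
Definition fp_inv (x : freeprod) : freeprod :=
  exist reduced _ (word_inv_reduced (valP x)).

Lemma fp_mulA : associative fp_mul.
Proof. by move=> x y z; apply: val_inj; rewrite /= word_mulA ?(valP y) ?(valP z). Qed.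

Lemma fp_mul1x : left_id fp_one fp_mul.
Proof. by move=> x; apply: val_inj. Qed.

Lemma fp_mulx1 : right_id fp_one fp_mul.
Proof. by move=> x; apply: val_inj; rewrite /= word_mulw0 ?(valP x). Qed.

Lemma fp_mulVx : left_inverse fp_one fp_inv fp_mul.
Proof. by move=> x; apply: val_inj; rewrite /= word_mulVw ?(valP x). Qed.

Lemma fp_mulxV : right_inverse fp_one fp_inv fp_mul.
Proof.
move=> x; have VK : fp_inv (fp_inv x) = x.
  apply: val_inj; rewrite /= /word_inv map_rev revK -map_comp.
  by rewrite map_id_in // => a _; exact: letterVK.
by rewrite -{1}VK fp_mulVx.
Qed.

HB.instance Definition _ := isGroup.Build freeprod
  fp_mulA fp_mul1x fp_mulx1 fp_mulVx fp_mulxV.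

Definition fp_inl (g : G) : freeprod :=
  exist reduced _ (@push_reduced (inl g) [::] isT).
Definition fp_inr (h : H) : freeprod :=
  exist reduced _ (@push_reduced (inr h) [::] isT).

Lemma fp_inlM : {morph fp_inl : x y / x * y}.
Proof.
move=> x y; apply: val_inj; rewrite /= push_inlM // (@word_mul_push (inl x) [::])
  // push_reduced //.
Qed.

Lemma fp_inrM : {morph fp_inr : x y / x * y}.
Proof.
move=> x y; apply: val_inj; rewrite /= push_inrM // (@word_mul_push (inr x) [::])
  // push_reduced //.
Qed.

HB.instance Definition _ := isMultiplicative.Build G freeprod fp_inl fp_inlM.
HB.instance Definition _ := isMultiplicative.Build H freeprod fp_inr fp_inrM.

Section Lift.
Variables (K : groupType) (f : {multiplicative G -> K}) (k : {multiplicative H -> K}).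

Definition letter_eval a : K := match a with inl g => f g | inr h => k h end.

Definition fp_lift (x : freeprod) : K :=
  foldr (fun a y => letter_eval a * y) 1 (val x).

Let mult1 (L : groupType) (m : {multiplicative L -> K}) : m 1 = 1.
Proof. by apply: (mulgI (m 1)); rewrite -gmulfM !mulg1. Qed.

Let foldr_push a w :
  foldr (fun a y => letter_eval a * y) 1 (push a w) =
  letter_eval a * foldr (fun a y => letter_eval a * y) 1 w.
Proof.
rewrite /push; case: ifPn => [|_].
  by case: a => x /= /eqP ->; rewrite mult1 mul1g.
case: a w => [g|h] [|[g'|h'] w] //=.
- by rewrite mulgA -gmulfM; case: eqP => [->|//]; rewrite mult1 mul1g.
- by rewrite mulgA -gmulfM; case: eqP => [->|//]; rewrite mult1 mul1g.
Qed.

Lemma fp_liftM : {morph fp_lift : x y / x * y}.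
Proof.
move=> x y; rewrite /fp_lift /=; elim: (val x) => /= [|a u IH].
  by rewrite mul1g.
by rewrite foldr_push IH mulgA.
Qed.

Lemma fp_lift_inl g : fp_lift (fp_inl g) = f g.
Proof. by rewrite /fp_lift /= foldr_push /= mulg1. Qed.

Lemma fp_lift_inr h : fp_lift (fp_inr h) = k h.
Proof. by rewrite /fp_lift /= foldr_push /= mulg1. Qed.

(* With [fp_lift], the universal property of the free product. *)
Lemma fp_lift_unique (m : {multiplicative freeprod -> K}) :
  (forall g, m (fp_inl g) = f g) -> (forall h, m (fp_inr h) = k h) ->
  m =1 fp_lift.
Proof.
move=> mf mk [w rw]; elim: w rw => [|a w IH] rw.
  by rewrite (_ : exist _ _ _ = 1 :> freeprod) ?mult1 //; exact: val_inj.
pose y : freeprod := exist reduced w (reduced_tail rw).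
pose x : freeprod := exist reduced _ (@push_reduced a [::] isT).
have -> : exist _ (a :: w) rw = x * y :> freeprod.
  by apply: val_inj; rewrite /= word_mul_push ?(reduced_tail rw) //= push_cons.
rewrite gmulfM fp_liftM [m y]IH; congr (_ * _).
rewrite /x; case: a {rw x y} => [g|h].
  by rewrite -[LHS]/(m (fp_inl g)) -[RHS]/(fp_lift (fp_inl g)) mf fp_lift_inl.
by rewrite -[LHS]/(m (fp_inr h)) -[RHS]/(fp_lift (fp_inr h)) mk fp_lift_inr.
Qed.

End Lift.

End FreeProduct.

Arguments freeprod : clear implicits.

Section Circle.
Variable R : realType.
Local Open Scope ring_scope.
Local Open Scope quotient_scope.

Definition unit_interval := set_type `[0, 1 : R]%classic.

Definition is_end (x : unit_interval) : bool := (set_val x == 0) || (set_val x == 1).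

Definition end_rel (x y : unit_interval) : bool := (x == y) || (is_end x && is_end y).

Let end_rel_refl : reflexive end_rel.
Proof. by move=> x; rewrite /end_rel eqxx. Qed.

Let end_rel_sym : symmetric end_rel.
Proof. by move=> x y; rewrite /end_rel eq_sym andbC. Qed.

Let end_rel_trans : transitive end_rel.
Proof.
move=> y x z; rewrite /end_rel => /predU1P[-> //|/andP[ex ey]].
by move=> /predU1P[<-|/andP[_ ez]]; rewrite ex ?ey ?ez orbT.
Qed.

Definition end_equiv := EquivRel end_rel end_rel_refl end_rel_sym end_rel_trans.

(* S^1 = [0,1]/{0=1} with the quotient topology. *)
Definition circle := {eq_quot end_equiv}.
HB.instance Definition _ := Quotient.on circle.
HB.instance Definition _ := Topological.copy circle (quotient_topology circle).

(* The representative of a point in [0,1). *)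
Definition coord (x : circle) : R :=
  let t : R := set_val (repr x) in if t == 1 then 0 else t.

Lemma coord_ge0 x : 0 <= coord x.
Proof.
rewrite /coord; case: ifP => // _.
by have := set_valP (repr x); rewrite /= in_itv /= => /andP[].
Qed.

Lemma coord_lt1 x : coord x < 1.
Proof.
rewrite /coord; case: ifPn => [_|tn1]; first exact: ltr01.
have := set_valP (repr x); rewrite /= in_itv /= => /andP[_ t1].
by rewrite lt_neqAle tn1.
Qed.

Lemma coord_inj : injective coord.
Proof.
move=> x y; rewrite /coord => xy.
rewrite -(reprK x) -(reprK y); apply/eqmodP; rewrite /= /end_rel /is_end.
move: xy; case: (eqVneq (set_val (repr x) : R) 1) => x1;
  case: (eqVneq (set_val (repr y) : R) 1) => y1 xy.
- by rewrite !orbT.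
- by rewrite -xy eqxx !orbT.
- by rewrite xy eqxx !orbT.
- by apply/orP; left; apply/eqP/val_inj.
Qed.

Lemma coord_pi (x : unit_interval) : set_val x != 1 -> coord (\pi_circle x) = set_val x.
Proof.
move=> x1; rewrite /coord.
have /eqmodP : \pi_circle (repr (\pi_circle x)) = \pi_circle x by rewrite reprK.
rewrite /= /end_rel /is_end => /predU1P[->|]; first by rewrite (negbTE x1).
move=> /andP[rx]; rewrite (negbTE x1) orbF => /eqP ->.
by case/orP: rx => /eqP ->; rewrite ?eqxx // eq_sym oner_eq0.
Qed.

Definition orientation (x y z : circle) : int :=
  let a := coord x in let b := coord y in let c := coord z in
  if [|| x == y, y == z | x == z] then 0
  else if [|| a < b < c, b < c < a | c < a < b] then 1
  else -1.

(* For homeomorphisms of the circle, preserving the orientation is preserving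
   the cyclic order of triples. *)
Definition homeo_plus (f : circle -> circle) : Prop :=
  [/\ continuous f,
      exists2 f' : circle -> circle, continuous f' & cancel f f' /\ cancel f' f
    & forall x y z, orientation (f x) (f y) (f z) = orientation x y z].

End Circle.

Definition sign3 := {z : int | z \in [:: -1; 0; 1]%R}.
HB.instance Definition _ := SubType.on sign3.
HB.instance Definition _ := Choice.on sign3.

Section CircularOrders.
Variable Gamma : groupType.
Local Open Scope ring_scope.

(* {-1,0,1}^(Gamma^3) with the product topology, {-1,0,1} being discrete. *)
Definition triple_maps :=
  {ptws (Gamma * Gamma * Gamma)%type -> discrete_topology sign3}.

Definition sign_of (phi : triple_maps) (x y z : Gamma) : int :=
  sval (phi (x, y, z)).

Definition CO : set triple_maps := [set phi |
  [/\ forall x y z, sign_of phi x y z = 0 <-> [\/ x = y, y = z | x = z],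
      forall g0 g1 g2 g3, sign_of phi g1 g2 g3 - sign_of phi g0 g2 g3
        + sign_of phi g0 g1 g3 - sign_of phi g0 g1 g2 = 0
    & forall g g0 g1 g2,
        sign_of phi (g * g0)%g (g * g1)%g (g * g2)%g = sign_of phi g0 g1 g2]].

Variable R : realType.

(* ]a, b[ is a complementary interval of A; b = 1 stands for the point 0 of the
   circle. This is meant for sets A containing the point 0. *)
Definition complementary_interval (A : set (circle R)) (a b : R) : Prop :=
  [/\ (@coord R @` A) a, (@coord R @` A) b \/ b = 1, a < b
    & forall x, A x -> ~~ (a < coord x < b)].

(* The last clause is what selects the complementary interval containing
   i (g_ n): the inductive condition at every stage n says that it holds for
   x, y, z among g_0, ..., g_n. *)
Definition midpoint_embedding (c : triple_maps) (g_ : nat -> Gamma)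
    (i : Gamma -> circle R) : Prop :=
  [/\ coord (i (g_ 0%N)) = 0,
      coord (i (g_ 1%N)) = 2^-1,
      forall n, (2 <= n)%N -> exists a b,
        complementary_interval [set i (g_ k) | k in [set k | (k < n)%N]] a b /\
        coord (i (g_ n)) = (a + b) / 2
    & forall x y z, orientation (i x) (i y) (i z) = sign_of c x y z].

(* The enumeration being a bijection with nat, this is the definition for a
   countably infinite Gamma. The extension of the action from i(Gamma) to the
   circle is an arbitrary one by orientation preserving homeomorphisms; it is
   unique on the closure of i(Gamma), and not required to be linear on gaps. *)
Definition dynamical_realization (c : triple_maps)
    (r : Gamma -> circle R -> circle R) : Prop :=
  [/\ forall g, homeo_plus (r g),
      r 1%g = id,
      forall g h, r (g * h)%g = r g \o r h
    & exists (g_ : nat -> Gamma) (i : Gamma -> circle R),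
        [/\ bijective g_, midpoint_embedding c g_ i
          & forall g x, r g (i x) = i (g * x)%g]].

End CircularOrders.

Definition minimal_action (R : realType) (G : groupType)
    (r : G -> circle R -> circle R) : Prop :=
  forall x, dense (range (fun g => r g x)).

(* Main.v *)
(* Let [p] be the base point. The right translates
   [c_e(x, y, z) = c(xe, ye, ze)] are circular orders converging to [c] as [e p]
   tends to [p], so if [c] is isolated, then [c_e = c] for every [e] with [e p]
   in some arc [p, v p). Right multiplication by such an [e] thus preserves [c]
   and commutes with the minimal action; hence it is archimedean: its powers go
   all the way round the circle. Hoelder's argument then shows that the whole
   group is abelian, which a free product of nontrivial groups is not. *)
Require Import Defs.
From HB Require Import structures.
From mathcomp Require Import all_boot all_order all_algebra.
From mathcomp Require Import all_classical all_reals all_analysis.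
From mathcomp Require Import lra.
(* Again, since [vector] also defines a [coord]. *)
Import Defs.
Import numFieldNormedType.Exports.
Set Implicit Arguments.
Unset Strict Implicit.
Unset Printing Implicit Defensive.
Import Order.TTheory GRing.Theory Num.Theory.
Local Open Scope classical_set_scope.

Definition cyc (R : realType) (a b c : R) : bool :=
  [|| a < b < c, b < c < a | c < a < b]%R.

Lemma cyc_lt (R : realType) (a b c : R) : cyc a b c -> (a < c -> a < b < c)%R.
Proof. by move=> /or3P[] /andP[? ?] ac //; lra. Qed.

(** * Hoelder's argument for a left-invariant cyclic order cut open at the identity *)

Section CoordinateOrder.
Variables (R : realType) (T : groupType) (k : T -> R).
Local Notation P x y z := (cyc (k x) (k y) (k z)).

Hypotheses (k_inj : injective k) (k_ge0 : forall x, (0 <= k x)%R).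
Hypothesis k1 : k 1%g = 0%R.
Hypothesis cyc_mull : forall g x y z, P (g * x)%g (g * y)%g (g * z)%g = P x y z.

Definition right_inv (e : T) : Prop :=
  forall x y z, P (x * e)%g (y * e)%g (z * e)%g = P x y z.

Local Open Scope group_scope.
Local Open Scope ring_scope.

Lemma k_gt0 x : x <> 1%g -> 0 < k x.
Proof. by move=> x1; rewrite lt_neqAle k_ge0 andbT -k1; apply/eqP => /k_inj/esym. Qed.

Lemma cyc1 x y : P 1%g x y = (0 < k x < k y).
Proof.
rewrite /cyc k1; have y0 := k_ge0 y.
by rewrite [k y < 0]ltNge y0 /= andbF !orbF.
Qed.

Lemma right_invM e f : right_inv e -> right_inv f -> right_inv (e * f)%g.
Proof. by move=> ie jf x y z; rewrite !mulgA jf ie. Qed.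

Lemma right_invX e n : right_inv e -> right_inv (e ^+ n)%g.
Proof.
move=> ie; elim: n => [|n IH]; first by move=> x y z; rewrite expg0 !mulg1.
by rewrite expgS; exact: right_invM.
Qed.

(** Conjugation by [e ^+ n] preserves the cyclic order and fixes [1] and [e], hence preserves the
    arc between them. *)
Lemma k_conjX_lt e s n : right_inv e -> k s < k e ->
  k (e ^- n * s * e ^+ n)%g < k e.
Proof.
move=> ie se; have [->|/eqP s1] := eqVneq s 1%g.
  by rewrite mulg1 mulVg k1; exact: le_lt_trans (k_ge0 s) se.
have : P 1%g s e by rewrite cyc1 k_gt0.
rewrite -(right_invX n ie) -(cyc_mull (e ^- n)%g) mul1g mulVg.
by rewrite -expgS expgSr mulKg mulgA cyc1 => /andP[].
Qed.

(* No wrap-around: [1 <= t < e <= e t < e^2] and [t <= s t < e t]. *)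
Lemma k_mul_lt e s t : right_inv t -> k e < k (e * e)%g ->
  k s < k e -> k t < k e -> k (s * t)%g < k (e * e)%g.
Proof.
move=> it ee se te.
have [->|/eqP s1] := eqVneq s 1%g; first by rewrite mul1g; exact: lt_trans ee.
have [->|/eqP t1] := eqVneq t 1%g; first by rewrite mulg1; exact: lt_trans ee.
have : P 1%g s e by rewrite cyc1 k_gt0.
have : P 1%g t e by rewrite cyc1 k_gt0.
rewrite -(cyc_mull e) -(it 1%g s e) mul1g mulg1 /cyc.
have := k_ge0 (s * t)%g.
by move=> ? /or3P[]/andP[? ?] /or3P[]/andP[? ?]; lra.
Qed.

(** Right translation of [1 < u < f] by [f] gives [f < u * f], so [u < v < u * f]; left translation
    by [u^-1] carries this triple to [1], [u^-1 * v], [f]. *)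
Lemma k_ldiv_lt f u v : right_inv f -> k f < k (f * f)%g ->
  k u < k v -> k v < k f -> k (u^-1 * v)%g < k f.
Proof.
move=> jf ff uv vf.
have [->|/eqP u1] := eqVneq u 1%g; first by rewrite invg1 mul1g.
have : P 1%g u f by rewrite cyc1 k_gt0 //; lra.
rewrite -jf mul1g => h1.
have : P u v (u * f)%g.
  have := k_gt0 u1; move: h1; rewrite /cyc.
  by move=> /or3P[]/andP[? ?] ?; apply/or3P; apply/Or31; lra.
by rewrite -(cyc_mull u^-1%g) mulVg mulKg cyc1 => /andP[].
Qed.

Hypothesis k_dense : forall eps : R, 0 < eps -> exists x, 0 < k x < eps.

Lemma k_below v w : v <> 1%g -> w <> 1%g ->
  exists2 e, e <> 1%g & k e < Num.min (k v) (k w).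
Proof.
move=> /k_gt0 v1 /k_gt0 w1.
have [|e /andP[e0 ew]] := k_dense (eps := Num.min (k v) (k w)).
  by rewrite lt_min v1 w1.
by exists e => // e1; rewrite e1 k1 ltxx in e0.
Qed.

Variable v0 : T.
Hypothesis v01 : v0 <> 1%g.
Hypothesis right_inv_small : forall x, k x < k v0 -> right_inv x.

(** Fix [1 < y < w]. For small [e], left translation gives [y < y * e < w], and right translation of
    [1 < e < y] gives [e < e * e < y * e]. *)
Lemma k_sqr_small w : w <> 1%g -> exists2 u, u <> 1%g &
  forall e, e <> 1%g -> k e < k u -> k e < k (e * e)%g /\ k (e * e)%g < k w.
Proof.
move=> w1; have [y y1 ywv] := k_below w1 v01.
have {ywv}[yw yv] : k y < k w /\ k y < k v0 by apply/andP; rewrite -lt_min.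
have z1 : (y^-1 * w)%g <> 1%g.
  by move=> /(congr1 (fun x => y * x)%g); rewrite mulVKg mulg1 => wy; rewrite wy ltxx in yw.
have [u u1 uyz] := k_below y1 z1; exists u => // e e1 eu.
have {uyz}[ey ez] : k e < k y /\ k e < k (y^-1 * w)%g.
  by apply/andP; rewrite -lt_min (lt_trans eu).
have ie : right_inv e by apply: right_inv_small; exact: lt_trans yv.
have : P 1%g e (y^-1 * w)%g by rewrite cyc1 k_gt0.
have : P 1%g e y by rewrite cyc1 k_gt0.
rewrite -(ie 1%g e y) -(cyc_mull y 1%g) mul1g mulg1 mulVKg /cyc.
have := k_gt0 e1; have := k_ge0 (e * e)%g.
by move=> ? ? /or3P[]/andP[? ?] /or3P[]/andP[? ?]; split; lra.
Qed.

Hypothesis k_arch : forall e a, e <> 1%g -> right_inv e -> k e < k (e * e)%g ->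
  exists n, k (e ^- n * a)%g < k e.

(* Hoelder's argument: with [a = e^m s] and [b = e^n t], where [s] and [t] lie
   in [1, e), both [ab] and [ba] lie in [e^(m+n), e^(m+n+2)), for every small
   [e]. *)
Lemma small_right_inv_comm (a b : T) : (a * b = b * a)%g.
Proof.
apply: contrapT => ab.
pose d := ((b * a)^-1 * (a * b))%g.
have d1 : d <> 1%g.
  by move=> /(congr1 (fun x => b * a * x)%g); rewrite mulVKg mulg1.
have dV1 : d^-1%g <> 1%g by move/eqP; rewrite invg_eq1 => /eqP.
have [w w1 wd] := k_below d1 dV1.
have {wd}[wd wdV] : k w < k d /\ k w < k d^-1%g by apply/andP; rewrite -lt_min.
(* Squaring is controlled twice, so that neither [e] nor [f = e^2] wraps around when squared, and
   [f < w]. *)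
have [u1 u11 u1w] := k_sqr_small w1.
have [y y1 yuw] := k_below u11 w1.
have {yuw}[yu yw] : k y < k u1 /\ k y < k w by apply/andP; rewrite -lt_min.
have [u2 u21 u2y] := k_sqr_small y1.
have [e e1 euv] := k_below u21 v01.
have {euv}[eu ev] : k e < k u2 /\ k e < k v0 by apply/andP; rewrite -lt_min.
have [ee eey] := u2y _ e1 eu.
set f := (e * e)%g in ee eey.
have f1 : f <> 1%g by move=> f1; have := k_ge0 e; rewrite leNgt -k1 -f1 ee.
have [ff ffw] := u1w _ f1 (lt_trans eey yu).
have ie := right_inv_small ev.
have jf : right_inv f by exact: right_invM.
have [m am] := k_arch a e1 ie ee.
have [n bn] := k_arch b e1 ie ee.
set s := (e ^- m * a)%g in am; set t := (e ^- n * b)%g in bn.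
(* These are the remainders of [b * a] and [a * b] after extracting [e ^+ (m + n)] on the left. *)
pose u := (e ^- m * t * e ^+ m * s)%g.
pose v := (e ^- n * s * e ^+ n * t)%g.
have uf : k u < k f.
  apply: k_mul_lt => //; first exact/right_inv_small/(lt_trans am).
  exact: k_conjX_lt.
have vf : k v < k f.
  apply: k_mul_lt => //; first exact/right_inv_small/(lt_trans bn).
  exact: k_conjX_lt.
have bau : (b * a = e ^+ (m + n) * u)%g.
  by rewrite /u /t /s addnC expgnDr -!mulgA !mulVKg.
have abv : (a * b = e ^+ (m + n) * v)%g.
  by rewrite /v /s /t expgnDr -!mulgA !mulVKg.
have dE : d = (u^-1 * v)%g by rewrite /d bau abv invgM -mulgA mulKg.
have dVE : d^-1%g = (v^-1 * u)%g by rewrite dE invgM invgK.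
have fw : k f < k w by exact: lt_trans yw.
(* Whichever remainder is smaller, [d] or [d^-1] falls below [f < w], against the choice of [w]. *)
have [uv|vu|/k_inj uv] := ltgtP (k u) (k v).
- have := k_ldiv_lt jf ff uv vf; rewrite -dE; lra.
- have := k_ldiv_lt jf ff vu uf; rewrite -dVE; lra.
- by apply: d1; rewrite dE uv mulVg.
Qed.

End CoordinateOrder.

(** * The quotient topology of the circle in terms of [coord] *)

Section CircleTopology.
Variable R : realType.
Local Open Scope ring_scope.
Implicit Types (x y z : circle R) (t : R).

Lemma coord_surj t : 0 <= t < 1 -> exists x, coord x = t.
Proof.
move=> /andP[t0 t1].
have tI : t \in (`[0, 1 : R]%classic : set R) by rewrite inE /= in_itv /= t0 ltW.
exists (\pi_(circle R)%qT (exist _ t tI : unit_interval R)).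
by rewrite coord_pi //= lt_eqF.
Qed.

(* At the base point [0] this neighbourhood is only one-sided. *)
Lemma coord_nbhs (O : set (circle R)) x : open O -> O x ->
  exists W : set R, [/\ open W, W (coord x) & forall y, W (coord y) -> O y].
Proof.
move=> [W oW WO] Ox.
have WE y : W (coord y) <-> O y.
  have tI : coord y \in (`[0, 1 : R]%classic : set R).
    by rewrite inE /= in_itv /= coord_ge0 ltW // coord_lt1.
  pose u : unit_interval R := exist _ (coord y) tI.
  have uy : \pi_(circle R)%qT u = y.
    by apply: coord_inj; rewrite coord_pi //= lt_eqF // coord_lt1.
  have := congr1 (fun S => S u) WO; rewrite /preimage /= uy => E.
  by rewrite -E.
by exists W; split => //; [exact/WE | move=> y /WE].
Qed.

Lemma coord_pi_end (u : unit_interval R) :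
  is_end u -> coord (\pi_(circle R)%qT u) = 0.
Proof.
move=> ue; have [|x x0] := @coord_surj 0; first by rewrite lexx ltr01.
suff -> : \pi_(circle R)%qT u = x by [].
rewrite -[x]reprK; apply/eqmodP; rewrite /= /end_rel ue /is_end.
move: x0; rewrite /coord; case: (eqVneq (set_val (repr x) : R) 1) => [_ _|_ ->].
  by rewrite !orbT.
by rewrite eqxx !orbT.
Qed.

(** The arc omits the glued point, so its preimage in [0, 1] is just []0, t[]. *)
Lemma open_arc t : t <= 1 -> open [set x : circle R | 0 < coord x < t].
Proof.
move=> t1; exists `]0, t[%classic; first exact: interval_open.
apply/seteqP; split => u; rewrite /preimage /= in_itv /=.
  by move=> /[dup] /andP[_ ut] h; rewrite coord_pi // lt_eqF // (lt_le_trans ut).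
have [u1|u1] := eqVneq (set_val u) 1; last by rewrite coord_pi.
by rewrite coord_pi_end ?ltxx // /is_end u1 eqxx orbT.
Qed.

Lemma orientationE x y z : orientation x y z =
  if [|| x == y, y == z | x == z] then 0
  else if cyc (coord x) (coord y) (coord z) then 1 else -1.
Proof. by []. Qed.

End CircleTopology.

(** * Swapped and interleaved cyclic triples *)

Section CyclicTriples.
Variable R : realType.
Local Open Scope ring_scope.
Implicit Types a b c : R.

Lemma cyc_swap a b c : a != b -> b != c -> a != c -> cyc b a c = ~~ cyc a b c.
Proof.
rewrite /cyc => ab bc ac.
by case: (ltgtP a b) ab => // ? _; case: (ltgtP b c) bc => // ? _;
  case: (ltgtP a c) ac => //= ? _; lra.
Qed.

(** The six points occur in the cyclic order [a, a', b, b', c, c']; every other one is taken. *)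
Lemma cyc_interleave a b c a' b' c' :
  cyc a b c -> cyc a a' b -> cyc b b' c -> cyc c c' a -> cyc a' b' c'.
Proof.
rewrite /cyc => /or3P[]/andP[? ?] /or3P[]/andP[? ?] /or3P[]/andP[? ?]
  /or3P[]/andP[? ?]; try (exfalso; lra).
all: apply/or3P; solve [apply/Or31; lra | apply/Or32; lra | apply/Or33; lra].
Qed.

End CyclicTriples.

(** * Right translates of a circular order *)

Section ConjugateOrder.
Variable T : groupType.
Local Open Scope ring_scope.

(** For left-invariant [c] this is also the pullback of [c] under conjugation [x] to [e^-1 * x * e],
    hence the name. *)
Definition conj_order (c : triple_maps T) (e : T) : triple_maps T :=
  fun t => c ((t.1.1 * e)%g, (t.1.2 * e)%g, (t.2 * e)%g).

Lemma conj_order_CO c e : CO c -> CO (conj_order c e).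
Proof.
move=> [c0 cC cH]; split => [x y z|g0 g1 g2 g3|g g0 g1 g2].
- rewrite [sign_of _ _ _ _]/(sign_of c (x * e)%g (y * e)%g (z * e)%g) c0.
  have eE a b : (a * e = b * e)%g <-> a = b by split=> [/mulIg|->].
  by split=> -[/eE|/eE|/eE] ?; by [apply: Or31|apply: Or32|apply: Or33].
- exact: cC.
- by rewrite -[LHS]/(sign_of c _ _ _) /= -!mulgA cH.
Qed.

End ConjugateOrder.

(** * Isolated orders with a minimal realization: small right translations and their powers *)

Section Realization.
Variables (R : realType) (T : groupType) (c : triple_maps T).
Hypothesis c_CO : CO c.
Variables (r : T -> circle R -> circle R) (i : T -> circle R) (g0 : T).
Hypothesis r_cont : forall g, continuous (r g).
Hypothesis r_i : forall g x, r g (i x) = i (g * x)%g.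
Hypothesis i_g0 : coord (i g0) = 0%R.
Hypothesis i_orient :
  forall x y z, orientation (i x) (i y) (i z) = sign_of c x y z.
Hypothesis r_minimal : minimal_action r.
Local Open Scope ring_scope.

(** The shift by [g0], the element placed at the point 0, puts the identity at the origin; left
    invariance keeps the cyclic order. *)
Let k x := coord (i (g0 * x)%g).
Local Notation P x y z := (cyc (k x) (k y) (k z)).

Lemma orbit_small x (eps : R) : 0 < eps -> exists g, 0 < coord (r g x) < eps.
Proof.
move=> eps0; pose t := Num.min eps 1.
have t0 : 0 < t by rewrite lt_min eps0 ltr01.
have t1 : t <= 1 by rewrite ge_min lexx orbT.
have [|y [/andP[y0 yt] [g _ gy]]] := @r_minimal x _ _ (open_arc t1).
  have [|y yt] := @coord_surj R (t / 2); first by apply/andP; split; lra.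
  by exists y; rewrite /= yt; apply/andP; split; lra.
exists g; rewrite gy y0 (lt_le_trans yt) //; by rewrite ge_min lexx.
Qed.

Lemma k_dense eps : 0 < eps -> exists x, 0 < k x < eps.
Proof.
move=> /(orbit_small (i g0))[g]; rewrite r_i => gi.
by exists (g0^-1 * (g * g0))%g; rewrite /k mulVKg.
Qed.

Lemma k_eq0 : k 1%g = 0.
Proof. by rewrite /k mulg1. Qed.

(** If [i x = i y], then [c] vanishes on [(x, y, z)] for all [z]; by density some [i z] differs from
    [i x], which forces [x = y]. *)
Lemma i_inj : injective i.
Proof.
move=> x y xy; apply: contrapT => nxy.
(* In both cases a coordinate strictly between 0 and [eps] differs from that of [i x]. *)
pose eps := if coord (i x) == 0 then 1 else coord (i x).
have eps0 : 0 < eps.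
  by rewrite /eps; case: ifPn => // x0; rewrite lt_neqAle eq_sym x0 coord_ge0.
have [g /andP[g1 g2]] := orbit_small (i g0) eps0; rewrite r_i in g1 g2.
set z := (g * g0)%g in g1 g2.
have iz : i z <> i x.
  by move=> zx; move: g1 g2; rewrite zx /eps; case: eqP => [->|_]; rewrite ltxx.
have [/(_ x y z) [+ _] _ _] := c_CO; rewrite -i_orient xy /orientation eqxx /=.
case=> // [yz|xz]; first by apply: iz; rewrite -yz xy.
by apply: iz; rewrite -xz.
Qed.

Lemma k_inj : injective k.
Proof. by move=> x y /coord_inj/i_inj/mulgI. Qed.

Lemma sign_ofE x y z : sign_of c x y z =
  if [|| x == y, y == z | x == z] then 0 else if P x y z then 1 else -1.
Proof.
have [_ _ cH] := c_CO; rewrite -(cH g0) -i_orient orientationE.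
by rewrite !(inj_eq i_inj) !(inj_eq (mulgI _)).
Qed.

Lemma cyc_sign x y z : P x y z = (sign_of c x y z == 1).
Proof.
rewrite sign_ofE; case: ifPn => [xyz|_]; last by case: ifP.
have -> : (0 == 1 :> int) = false by [].
by move: xyz; rewrite /cyc => /or3P[]/eqP->; apply/negbTE/negP => /or3P[]/andP[? ?];
  lra.
Qed.

Lemma cyc_k_mull g x y z : P (g * x)%g (g * y)%g (g * z)%g = P x y z.
Proof. by have [_ _ cH] := c_CO; rewrite !cyc_sign cH. Qed.

Lemma k_between x y e : x <> y -> e <> 1%g -> k e < k (x^-1 * y)%g ->
  P x (x * e)%g y.
Proof.
move=> xy e1 ey; rewrite -(cyc_k_mull x^-1%g) mulVg mulKg.
by rewrite (cyc1 _ k_eq0) ?ey ?(k_gt0 k_inj _ k_eq0) // => ?; exact: coord_ge0.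
Qed.

(* If [e] is small then [x e], [y e], [z e] interleave with [x], [y], [z]. *)
Lemma sign_conj_near x y z : exists2 v, v <> 1%g &
  forall e, k e < k v -> sign_of c (x * e)%g (y * e)%g (z * e)%g = sign_of c x y z.
Proof.
have [xyz|xyz] := boolP [|| x == y, y == z | x == z].
  have [v /andP[v0 _]] := k_dense ltr01.
  exists v => [v1|e _]; first by rewrite v1 k_eq0 ltxx in v0.
  by rewrite !sign_ofE !(inj_eq (mulIg _)) xyz.
suff [v v1 Pv] : exists2 v, v <> 1%g & forall e, e <> 1%g -> k e < k v ->
    P (x * e)%g (y * e)%g (z * e)%g = P x y z.
  exists v => // e ev; have [->|/eqP e1] := eqVneq e 1%g; first by rewrite !mulg1.
  by rewrite !sign_ofE !(inj_eq (mulIg _)) (Pv e e1 ev).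
move: xyz; rewrite !negb_or => /and3P[].
have key a b d : a <> b -> b <> d -> a <> d -> P a b d ->
    exists2 v, v <> 1%g & forall e, e <> 1%g -> k e < k v ->
    P (a * e)%g (b * e)%g (d * e)%g.
  have ne (p q : T) : p <> q -> (p^-1 * q)%g <> 1%g.
    by move=> pq /(congr1 (fun t => p * t)%g); rewrite mulVKg mulg1 => /esym.
  move=> ab bd ad Pabd.
  (* With [v] below [a^-1 * b], [b^-1 * d] and [d^-1 * a], each translated point stays before the
     next original one. *)
  have below := k_below k_inj (fun _ => coord_ge0 _) k_eq0 k_dense.
  have [v1 v11 v1E] := below _ _ (ne _ _ ab) (ne _ _ bd).
  have [v v1' vE] := below _ _ v11 (ne _ _ (nesym ad)).
  exists v => // e e1 ev.
  move: vE v1E; rewrite !lt_min => /andP[vv1 vad] /andP[vab vbd].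
  apply: cyc_interleave Pabd _ _ _; apply: k_between => //; try exact/nesym; lra.
move=> /eqP xy /eqP yz /eqP xz.
have [Pxyz|nPxyz] := boolP (P x y z); first exact: key.
have sw (a b d : T) : a <> b -> b <> d -> a <> d -> P b a d = ~~ P a b d.
  by move=> *; apply: cyc_swap; apply/eqP => /k_inj.
(* A negative triple becomes positive when its first two entries are swapped. *)
have [|v v1 Pv] := key _ _ _ (nesym xy) xz yz; first by rewrite sw.
exists v => // e e1 /(Pv e e1); rewrite sw; first exact: negbTE.
all: by move=> /mulIg.
Qed.

Lemma isolated_right_inv : isolated (@CO T) c ->
  exists2 v, v <> 1%g & forall e, k e < k v -> right_inv k e.
Proof.
move=> [_ [V Vc VCO]].
(* The filter of elements tending to the identity from the positive side. *)
pose F : set_system T := [set A | exists2 v, v <> 1%g & forall e, k e < k v -> A e].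
have FF : Filter F.
  split=> [|A B [v v1 vA] [w w1 wB]|A B AB [v v1 vA]].
  - have [v /andP[v0 _]] := k_dense ltr01.
    by exists v => // v1; rewrite v1 k_eq0 ltxx in v0.
  - have [u u1] := k_below k_inj (fun _ => coord_ge0 _) k_eq0 k_dense v1 w1.
    rewrite lt_min => /andP[uv uw]; exists u => // e eu.
    by split; [apply: vA|apply: wB]; exact: lt_trans eu _.
  - by exists v => // e /vA; exact: AB.
have : conj_order c @ F --> c.
  (* Convergence in the product topology is checked at one triple at a time. *)
  apply/cvg_sup => -[[x y] z] U [_ [[W _ <-] Wc] /filterS]; apply.
  have [v v1 vE] := sign_conj_near x y z; exists v => // e /vE E.
  rewrite /= (_ : conj_order c e (x, y, z) = c (x, y, z)) //.
  exact: val_inj.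
move=> /(_ _ Vc) [v v1 vV]; exists v => // e /vV Ve x y z.
have ce : conj_order c e = c.
  have : (V `&` (@CO T)) (conj_order c e) by split => //; exact: conj_order_CO.
  by rewrite VCO.
by rewrite !cyc_sign -[in RHS]ce.
Qed.

(* Otherwise the points [e^n] increase to a limit [p]; by minimality some [g p]
   lies in the arc from [1] to [e], but right multiplication by [e] pushes the
   points [g e^n] out of that arc. *)
Lemma right_inv_arch e a : e <> 1%g -> right_inv k e -> k e < k (e * e)%g ->
  exists n, k (e ^- n * a)%g < k e.
Proof.
move=> e1 ie ee; apply: contrapT => /forallNP nE.
have {}nE n : k e <= k (e ^- n * a)%g by rewrite leNgt; apply/negP/nE.
have k0 := fun x : T => coord_ge0 (i (g0 * x)%g).
have e0 : 0 < k e := k_gt0 k_inj k0 k_eq0 e1.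
(* The powers cannot jump over [a]: translated back by [e ^- n], this says [e <= e ^- n * a]. *)
have inc n : k (e ^+ n)%g < k (e ^+ n.+1)%g /\ k (e ^+ n.+1)%g <= k a.
  elim: n => [|n [IH1 IH2]].
    by rewrite expg0 expg1 k_eq0 e0; have := nE 0%N; rewrite expg0 invg1 mul1g.
  have [ena|ena] := eqVneq (e ^+ n.+1)%g a.
    by have := nE n.+1; rewrite ena mulVg k_eq0 leNgt e0.
  have lta : k (e ^+ n.+1)%g < k a.
    by rewrite lt_neqAle IH2 andbT (inj_eq k_inj).
  have := nE n.+1; rewrite le_eqVlt => /orP[/eqP/k_inj eE|le].
    have -> : (e ^+ n.+2)%g = a by rewrite expgSr {2}eE mulVKg.
    by [].
  have : P 1%g e (e ^- n.+1 * a)%g by rewrite (cyc1 k0 k_eq0) e0.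
  rewrite -(cyc_k_mull (e ^+ n.+1)%g) mulg1 mulVKg -expgSr.
  by move=> /cyc_lt/(_ lta)/andP[? /ltW].
pose u n := k (e ^+ n)%g.
have u_cvg : cvgn u.
  apply: nondecreasing_is_cvgn.
    by apply/nondecreasing_seqP => n; have [/ltW] := inc n.
  by exists (k a) => _ [n _ <-]; rewrite (le_trans _ (inc n).2) // ltW // (inc n).1.
have L0 : 0 <= limn u by apply: limr_ge => //; apply: nearW => n; exact: k0.
(* The bound [k a < 1] keeps the limit away from the cut, so it is the coordinate of a point [p]. *)
have L1 : limn u < 1.
  apply: le_lt_trans (coord_lt1 (i (g0 * a)%g)); apply: limr_le => //.
  by apply: nearW => n; rewrite (le_trans _ (inc n).2) // ltW // (inc n).1.
have [p pL] : exists p, coord p = limn u by apply: coord_surj; rewrite L0.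
have [g gp] := orbit_small p e0.
have ke1 : k e <= 1 by rewrite ltW // coord_lt1.
have := open_comp (fun x _ => @r_cont g x) (open_arc ke1).
move=> /coord_nbhs -/(_ p gp)[W [oW Wp WO]].
have [N _ NW] : \forall n \near \oo, W (u n).
  by apply: u_cvg; rewrite -pL; apply: open_nbhs_nbhs.
(* Conjugating by [g0] expresses the action of [g] in the shifted coordinate [k]. *)
have kyE m : (N <= m)%N -> 0 < k (g0^-1 * g * g0 * e ^+ m)%g < k e.
  by move=> /NW /WO /=; rewrite r_i /k -!mulgA mulVKg.
have [y ye yee] : exists2 y, 0 < k y < k e & k (y * e)%g < k e.
  exists (g0^-1 * g * g0 * e ^+ N)%g; first exact: kyE.
  by rewrite -mulgA -expgSr; have /andP[] := kyE _ (leqnSn N).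
(* Right translation by [e] turns [1 < y < e] into [e < y * e], a contradiction. *)
have : P 1%g y e by rewrite (cyc1 k0 k_eq0).
rewrite -ie mul1g => /cyc_lt/(_ ee)/andP[/lt_trans/(_ yee)].
by rewrite ltxx.
Qed.

Lemma isolated_abelian : isolated (@CO T) c -> forall a b : T, (a * b = b * a)%g.
Proof.
move=> /isolated_right_inv [v v1 vE] a b.
apply: (small_right_inv_comm k_inj _ k_eq0 cyc_k_mull k_dense v1 vE).
  by move=> x; exact: coord_ge0.
by move=> e {}a e1 ie ee; exact: right_inv_arch.
Qed.

End Realization.

(** * Contradiction with the noncommutativity of the free product *)

Lemma infinite_group_nontriv (G : groupType) :
  infinite_set [set: G] -> exists g : G, g <> 1%g.
Proof.
move=> Ginf; apply: contrapT => /forallNP G1; apply: Ginf.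
rewrite (_ : setT = [set 1%g]) //.
by apply/seteqP; split => // g _; apply: contrapT => /G1.
Qed.

Theorem theorem4p6 (R : realType) (G H : groupType)
  (G_countable : countable [set: G]) (G_infinite : infinite_set [set: G])
  (H_countable : countable [set: H]) (H_infinite : infinite_set [set: H])
  (c : triple_maps (freeprod G H)) (c_CO : CO c)
  (c_minimal : exists2 r : freeprod G H -> circle R -> circle R,
    dynamical_realization c r & minimal_action (fun g : G => r (fp_inl H g))) :
  ~ isolated (@CO (freeprod G H)) c.
Proof.
move=> ciso.
have [r [r_homeo _ _ [g_ [i [_ [i0 _ _ i_or] r_i]]]] Gmin] := c_minimal.
have r_cont g : continuous (r g) by have [] := r_homeo g.
have r_min : minimal_action r.
  move=> x O O0 oO; have [y [Oy [g _ gy]]] := Gmin x O O0 oO.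
  by exists y; split => //; exists (fp_inl H g).
have [g /eqP g1] := infinite_group_nontriv G_infinite.
have [h /eqP h1] := infinite_group_nontriv H_infinite.
have comm := isolated_abelian c_CO r_cont r_i i0 i_or r_min ciso.
have := comm (fp_inl H g) (fp_inr G h).
(* The two products are distinct reduced words: one starts in [G], the other in [H]. *)
move=> /(congr1 val) /=.
by rewrite /word_mul /push /= (negbTE g1) (negbTE h1) /= (negbTE g1) (negbTE h1).
Qed.
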